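(* Let $n\neq m$, and suppose that every critical point of $\Pi$ is non-singular, i.e. $\nabla\Pi(x)=0$ implies $\det\nabla^2\Pi(x)\neq0$. Let $\bar\varsigma\in\mathcal{S}_a$ be a critical point of $\Pi^d$ and let $\bar x=[\mathbf{G}(\bar\varsigma)]^{-1}f$. (i) If $\bar\varsigma\in\mathcal{S}_a^+$, then $$\Pi(\bar x)=\min_{x\in\mathbb{R}^n}\Pi(x)\iff\max_{\varsigma\in\mathcal{S}_a^+}\Pi^d(\varsigma)=\Pi^d(\bar\varsigma).$$ (ii) If $\bar\varsigma\in\mathcal{S}_a^-$, then there exists a neighborhood $\mathcal{X}_o\times\mathcal{S}_o\subset\mathbb{R}^n\times\mathcal{S}_a^-$ of $(\bar x,\bar\varsigma)$ such that $$\Pi(\bar x)=\max_{x\in\mathcal{X}_o}\Pi(x)\iff\max_{\varsigma\in\mathcal{S}_o}\Pi^d(\varsigma)=\Pi^d(\bar\varsigma),$$ and such that the double-min duality holds in the following forms: 1. If $m<n$ and $\bar\varsigma$ is a local minimizer of $\Pi^d$, then $\bar x$ is a saddle point of $\Pi$, and there is a matrix $\mathbf{P}\in\mathbb{R}^{n\times m}$ with $\operatorname{rank}(\mathbf{P})=m$ and $\mathbf{P}^T\nabla^2\Pi(\bar x)\mathbf{P}\succeq0$, with columns $p_1,\dots,p_m$, such that, with $\mathcal{X}_\flat=\{\bar x+\theta_1p_1+\cdots+\theta_mp_m:\theta_1,\dots,\theta_m\in\mathbb{R}\}$, $$\Pi(\bar x)=\min_{x\in\mathcal{X}_o\cap\mathcal{X}_\flat}\Pi(x)=\min_{\varsigma\in\mathcal{S}_o}\Pi^d(\varsigma)=\Pi^d(\bar\varsigma).$$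 2. If $m>n$ and $\bar x$ is a local minimizer of $\Pi$, then $\bar\varsigma$ is a saddle point of $\Pi^d$, and there is a matrix $\mathbf{Q}\in\mathbb{R}^{m\times n}$ with $\operatorname{rank}(\mathbf{Q})=n$ and $\mathbf{Q}^T\nabla^2\Pi^d(\bar\varsigma)\mathbf{Q}\succeq0$, with columns $q_1,\dots,q_n$, such that, with $\mathcal{S}_\flat=\{\bar\varsigma+\vartheta_1q_1+\cdots+\vartheta_nq_n:\vartheta_1,\dots,\vartheta_n\in\mathbb{R}\}$, $$\Pi(\bar x)=\min_{x\in\mathcal{X}_o}\Pi(x)=\min_{\varsigma\in\mathcal{S}_o\cap\mathcal{S}_\flat}\Pi^d(\varsigma)=\Pi^d(\bar\varsigma).$$
   Context: Let $n,m$ be positive integers, let $\mathbf{A}\in\mathbb{R}^{n\times n}$ and $\mathbf{B}^1,\dots,\mathbf{B}^m\in\mathbb{R}^{n\times n}$ be symmetric matrices, $f\in\mathbb{R}^n$, and $d=(d^1,\dots,d^m)\in\mathbb{R}^m$. Define the primal function $\Pi:\mathbb{R}^n\to\mathbb{R}$ by $$\Pi(x)=\frac12\sum_{k=1}^m\Big(\frac12x^T\mathbf{B}^kx-d^k\Big)^2+\frac12x^T\mathbf{A}x-x^Tf .$$ For $\varsigma\in\mathbb{R}^m$ put $\mathbf{G}(\varsigma)=\mathbf{A}+\sum_{k=1}^m\varsigma_k\mathbf{B}^k$, and let $$\mathcal{S}_a=\{\varsigma\in\mathbb{R}^m : f \text{ lies in the column space of } \mathbf{G}(\varsigma)\}.$$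 The canonical dual function $\Pi^d:\mathcal{S}_a\to\mathbb{R}$ is $$\Pi^d(\varsigma)=-\frac12f^T[\mathbf{G}(\varsigma)]^{-1}f-\frac12\varsigma^T\varsigma-\varsigma^Td,$$ where $[\mathbf{G}(\varsigma)]^{-1}$ is understood as the generalized inverse if $\det\mathbf{G}(\varsigma)=0$. A critical point of $\Pi^d$ is a point $\varsigma\in\mathcal{S}_a$ with $\nabla\Pi^d(\varsigma)=0$, where the $k$-th component of the gradient is $$\frac12f^T[\mathbf{G}(\varsigma)]^{-1}\mathbf{B}^k[\mathbf{G}(\varsigma)]^{-1}f-\varsigma_k-d^k,\qquad k=1,\dots,m .$$ Further, $\mathcal{S}_a^+=\{\varsigma\in\mathcal{S}_a:\mathbf{G}(\varsigma)\succeq0\}$ (positive semidefinite) and $\mathcal{S}_a^-=\{\varsigma\in\mathcal{S}_a:\mathbf{G}(\varsigma)\prec0\}$ (negative definite). A saddle point is a critical point that is neither a local minimizer nor a local maximizer. *)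

(* Defs.v *)
From mathcomp Require Import all_boot all_order all_algebra.
From mathcomp Require Import all_classical all_reals all_analysis.

Set Implicit Arguments.
Unset Strict Implicit.
Unset Printing Implicit Defensive.

Import Order.TTheory GRing.Theory Num.Theory.
Import numFieldNormedType.Exports.

Local Open Scope classical_set_scope.
Local Open Scope ring_scope.

Section LinearAlgebra.
Context {R : realFieldType}.

Definition qform n (M : 'M[R]_n) (x : 'cV[R]_n) : R := (x^T *m M *m x) 0 0.

Definition possemidef n (M : 'M[R]_n) : Prop :=
  M^T = M /\ forall x : 'cV[R]_n, 0 <= qform M x.

Definition negdef n (M : 'M[R]_n) : Prop :=
  M^T = M /\ forall x : 'cV[R]_n, x != 0 -> qform M x < 0.

(* The Moore-Penrose inverse.  [pinvmx] of mxalgebra is only some solution X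
   of A X A = A, whereas the dual gradient below depends on which one is taken.
   We use the full-rank factorization A = C F of [mulmx_base], which gives
   A^+ = F^T (F F^T)^-1 (C^T C)^-1 C^T. *)
Definition mpinvmx m n (A : 'M[R]_(m, n)) : 'M[R]_(n, m) :=
  (row_base A)^T *m invmx (row_base A *m (row_base A)^T) *m
  invmx ((col_base A)^T *m col_base A) *m (col_base A)^T.

Definition penrose m n (A : 'M[R]_(m, n)) (X : 'M[R]_(n, m)) : Prop :=
  [/\ A *m X *m A = A, X *m A *m X = X,
      (A *m X)^T = A *m X & (X *m A)^T = X *m A].

Lemma mulmx_trr_eq0 m n (A : 'M[R]_(m, n)) : A *m A^T = 0 -> A = 0.
Proof.
move=> A0; apply/matrixP => i j; rewrite mxE.
have : (A *m A^T) i i = 0 by rewrite A0 mxE.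
rewrite mxE => /eqP; rewrite psumr_eq0 => [/allP/(_ j)|k _]; last first.
  by rewrite mxE -expr2 sqr_ge0.
by rewrite mem_index_enum mxE -expr2 sqrf_eq0 => /(_ isT)/eqP.
Qed.

Lemma unitmx_gram m n (A : 'M[R]_(m, n)) : row_free A -> A *m A^T \in unitmx.
Proof.
move=> Afree; rewrite -row_free_unit -kermx_eq0.
set K := kermx _; have K0 : K *m A *m A^T = 0 by rewrite -mulmxA mulmx_ker.
have KA0 : K *m A = 0.
  by apply: mulmx_trr_eq0; rewrite trmx_mul mulmxA K0 mul0mx.
by rewrite -(mulmx_free_eq0 K Afree) KA0.
Qed.

Lemma penrose_full_rank m n r (C : 'M[R]_(m, r)) (F : 'M[R]_(r, n)) :
  F *m F^T \in unitmx -> C^T *m C \in unitmx ->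
  penrose (C *m F)
    (F^T *m invmx (F *m F^T) *m invmx (C^T *m C) *m C^T).
Proof.
move=> UF UC; set X := (X in penrose _ X).
have AX : C *m F *m X = C *m invmx (C^T *m C) *m C^T.
  by rewrite /X -!mulmxA (mulmxA F) (mulKVmx UF).
have XA : X *m (C *m F) = F^T *m invmx (F *m F^T) *m F.
  by rewrite /X -!mulmxA (mulmxA C^T) (mulKmx UC).
split.
- by rewrite AX -!mulmxA (mulmxA C^T) (mulKmx UC).
- by rewrite XA /X -!mulmxA (mulmxA F F^T) (mulKVmx UF).
- by rewrite AX !trmx_mul trmxK trmx_inv trmx_mul trmxK mulmxA.
- by rewrite XA !trmx_mul trmxK trmx_inv trmx_mul trmxK mulmxA.
Qed.

Lemma penrose_mpinvmx m n (A : 'M[R]_(m, n)) : penrose A (mpinvmx A).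
Proof.
rewrite -{1}[A]mulmx_base; apply: penrose_full_rank.
  by apply: unitmx_gram; exact: row_base_free.
rewrite -{2}[col_base A]trmxK; apply: unitmx_gram.
by rewrite /row_free mxrank_tr; exact: col_base_full.
Qed.

Lemma penrose_uniq m n (A : 'M[R]_(m, n)) X Y :
  penrose A X -> penrose A Y -> X = Y.
Proof.
move=> [AXA XAX AXt XAt] [AYA YAY AYt YAt].
have AXY : A *m X = A *m Y.
  by rewrite -{1}AYA -[_ *m A *m X]mulmxA -AYt -AXt -trmx_mul mulmxA AXA AYt.
have XYA : X *m A = Y *m A.
  transitivity ((X *m A) *m (Y *m A)).
    by rewrite -mulmxA (mulmxA A Y A) AYA.
  by rewrite -XAt -YAt -trmx_mul -mulmxA (mulmxA A X A) AXA.
by rewrite -XAX XYA -mulmxA AXY mulmxA.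
Qed.

Lemma mpinvmx_unit n (A : 'M[R]_n) : A \in unitmx -> mpinvmx A = invmx A.
Proof.
move=> UA; apply: (penrose_uniq (penrose_mpinvmx A)).
by split; rewrite ?(mulmxV, mulVmx) ?mul1mx ?trmx1.
Qed.

End LinearAlgebra.

Section Calculus.
Context {R : realType}.

Definition gradient n (g : 'cV[R]_n -> R) (x : 'cV[R]_n) : 'cV[R]_n :=
  \col_i 'D_(delta_mx i 0) g x.

Definition hessian n (g : 'cV[R]_n -> R) (x : 'cV[R]_n) : 'M[R]_n :=
  \matrix_(i, j) 'D_(delta_mx i 0) (fun y => 'D_(delta_mx j 0) g y) x.

Definition is_min_over T (D : set T) (g : T -> R) (v : R) : Prop :=
  (g @` D) v /\ lbound (g @` D) v.

Definition is_max_over T (D : set T) (g : T -> R) (v : R) : Prop :=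
  (g @` D) v /\ ubound (g @` D) v.

Definition local_minimizer (T : topologicalType) (D : set T) (g : T -> R)
    (x : T) : Prop :=
  D x /\ \forall y \near within D (nbhs x), g x <= g y.

Definition local_maximizer (T : topologicalType) (D : set T) (g : T -> R)
    (x : T) : Prop :=
  D x /\ \forall y \near within D (nbhs x), g y <= g x.

(* [crit] is the set of critical points of [g] on its domain [D]. *)
Definition saddle_point (T : topologicalType) (crit D : set T) (g : T -> R)
    (x : T) : Prop :=
  [/\ crit x, ~ local_minimizer D g x & ~ local_maximizer D g x].

Definition affine_span n p (x : 'cV[R]_n) (P : 'M[R]_(n, p)) : set 'cV[R]_n :=
  [set x + \sum_k t k 0 *: col k P | t in [set: 'cV[R]_p]].

End Calculus.

Section CanonicalDuality.
Context {R : realType} {n m : nat}.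
Context (A : 'M[R]_n) (B : 'I_m -> 'M[R]_n) (f : 'cV[R]_n) (d : 'cV[R]_m).

Definition primal (x : 'cV[R]_n) : R :=
  2^-1 * (\sum_k (2^-1 * qform (B k) x - d k 0) ^+ 2)
  + 2^-1 * qform A x - (x^T *m f) 0 0.

Definition primal_critical : set 'cV[R]_n := [set x | gradient primal x = 0].

Definition Gmx (s : 'cV[R]_m) : 'M[R]_n := A + \sum_k s k 0 *: B k.

Definition Sa : set 'cV[R]_m := [set s | exists y : 'cV[R]_n, f = Gmx s *m y].

Definition Sa_plus : set 'cV[R]_m := [set s | Sa s /\ possemidef (Gmx s)].

Definition Sa_minus : set 'cV[R]_m := [set s | Sa s /\ negdef (Gmx s)].

(* The dual function is meaningful on [Sa] only; outside of it the value is
   junk, and every use is restricted to (a subset of) [Sa]. *)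
Definition dual (s : 'cV[R]_m) : R :=
  - (2^-1 * qform (mpinvmx (Gmx s)) f) - 2^-1 * (s^T *m s) 0 0
  - (s^T *m d) 0 0.

(* [Sa] need not be open, so criticality of the dual function is defined by
   this closed formula rather than by partial derivatives. *)
Definition dual_gradient (s : 'cV[R]_m) : 'cV[R]_m :=
  \col_k (2^-1 * (f^T *m mpinvmx (Gmx s) *m B k *m mpinvmx (Gmx s) *m f) 0 0
          - s k 0 - d k 0).

Definition dual_critical : set 'cV[R]_m :=
  [set s | Sa s /\ dual_gradient s = 0].

End CanonicalDuality.

(* Main.v *)
Require Import Defs.
From mathcomp Require Import all_boot all_order all_algebra.
From mathcomp Require Import all_classical all_reals all_analysis.
From mathcomp Require Import ring lra.

(* Write x for the primal point attached to a critical dual point s, G = G(s),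
   and F for the matrix with columns B^k x. The primal and dual gap is an exact
   sum of squares,
     Pi(y) - Pid(r) = 1/2 |xi(y) - r|^2 + 1/2 (y - z)^T G(r) (y - z)
   with xi(y)_k = 1/2 y^T B^k y - d^k and G(r) z = f, which settles (i).
   Both functions also have exact second-order expansions
     Pi(y) - Pi(x) = 1/2 (y - x)^T N(y) (y - x),
     Pid(r) - Pid(s) = 1/2 (r - s)^T M(r) (r - s)
   with N, M continuous, N(x) = H = G + F F^T and M(s) = K = - (1 + F^T G^-1 F).
   If G is negative definite, nonsingularity of H makes K nonsingular, so local
   extrema are read off from definite Hessians. Then (ii) is linear algebra: H
   and K are negative definite together, and P = G^-1 F, Q = F^T satisfy
     P^T H P = K^2 + K,   Q^T K Q = H - H G^-1 H,
   which are positive definite when K, respectively H, is. *)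

Set Implicit Arguments.
Unset Strict Implicit.
Unset Printing Implicit Defensive.

Import Order.TTheory GRing.Theory Num.Theory.
Import numFieldNormedType.Exports.

Local Open Scope classical_set_scope.
Local Open Scope ring_scope.

(** * Symmetric matrices and quadratic forms *)

Section DotProduct.
Context {R : realFieldType}.

Definition dot n (u v : 'cV[R]_n) : R := (u^T *m v) 0 0.

Lemma dotC n (u v : 'cV[R]_n) : dot u v = dot v u.
Proof. by rewrite /dot -[in LHS](trmxK v) -trmx_mul mxE. Qed.

Lemma dotDl n (u v w : 'cV[R]_n) : dot (u + v) w = dot u w + dot v w.
Proof. by rewrite /dot linearD mulmxDl mxE. Qed.

Lemma dotDr n (u v w : 'cV[R]_n) : dot w (u + v) = dot w u + dot w v.
Proof. by rewrite !(dotC w) dotDl. Qed.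

Lemma dotZl n a (u v : 'cV[R]_n) : dot (a *: u) v = a * dot u v.
Proof. by rewrite /dot linearZ -scalemxAl mxE. Qed.

Lemma dotZr n a (u v : 'cV[R]_n) : dot u (a *: v) = a * dot u v.
Proof. by rewrite !(dotC u) dotZl. Qed.

Lemma dotNl n (u v : 'cV[R]_n) : dot (- u) v = - dot u v.
Proof. by rewrite -scaleN1r dotZl mulN1r. Qed.

Lemma dotNr n (u v : 'cV[R]_n) : dot u (- v) = - dot u v.
Proof. by rewrite !(dotC u) dotNl. Qed.

Lemma dot0r n (u : 'cV[R]_n) : dot u 0 = 0.
Proof. by rewrite /dot mulmx0 mxE. Qed.

Lemma dot_mulmxl n p (M : 'M[R]_(n, p)) u v : dot (M *m u) v = dot u (M^T *m v).
Proof. by rewrite /dot trmx_mul mulmxA. Qed.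

Lemma dot_mulmxr n p (M : 'M[R]_(p, n)) u v : dot u (M *m v) = dot (M^T *m u) v.
Proof. by rewrite dot_mulmxl trmxK. Qed.

Lemma dotE n (u v : 'cV[R]_n) : dot u v = \sum_k u k 0 * v k 0.
Proof. by rewrite /dot mxE; apply: eq_bigr => k _; rewrite mxE. Qed.

Lemma dot_delta n (u : 'cV[R]_n) i : dot u (delta_mx i 0) = u i 0.
Proof.
rewrite dotE (bigD1 i) //= mxE !eqxx mulr1 big1 ?addr0 // => j ji.
by rewrite mxE (negbTE ji) mulr0.
Qed.

Lemma dot_ge0 n (u : 'cV[R]_n) : 0 <= dot u u.
Proof. by rewrite dotE; apply: sumr_ge0 => k _; rewrite -expr2 sqr_ge0. Qed.

Lemma dot_eq0 n (u : 'cV[R]_n) : (dot u u == 0) = (u == 0).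
Proof.
apply/eqP/eqP => [|->]; last exact: dot0r.
move=> u0; apply: trmx_inj; rewrite trmx0; apply: mulmx_trr_eq0.
by apply/matrixP => i j; rewrite !ord1 trmxK [RHS]mxE.
Qed.

Lemma dot_gt0 n (u : 'cV[R]_n) : (0 < dot u u) = (u != 0).
Proof. by rewrite lt0r dot_ge0 andbT dot_eq0. Qed.

Lemma qformE n (M : 'M[R]_n) x : qform M x = dot x (M *m x).
Proof. by rewrite /qform /dot mulmxA. Qed.

Lemma qformD n (M N : 'M[R]_n) x : qform (M + N) x = qform M x + qform N x.
Proof. by rewrite !qformE mulmxDl dotDr. Qed.

Lemma qformN n (M : 'M[R]_n) x : qform (- M) x = - qform M x.
Proof. by rewrite !qformE mulNmx dotNr. Qed.

Lemma qformZr n (M : 'M[R]_n) a x : qform M (a *: x) = a ^+ 2 * qform M x.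
Proof. by rewrite !qformE -scalemxAr dotZl dotZr mulrA expr2. Qed.

Lemma qform0 n (M : 'M[R]_n) : qform M 0 = 0.
Proof. by rewrite qformE mulmx0 dot0r. Qed.

Lemma qform_mulmx n p (M : 'M[R]_n) (P : 'M[R]_(n, p)) u :
  qform M (P *m u) = qform (P^T *m M *m P) u.
Proof. by rewrite !qformE dot_mulmxl !mulmxA. Qed.

Lemma congr_sym n p (M : 'M[R]_n) (P : 'M[R]_(n, p)) : M^T = M ->
  (P^T *m M *m P)^T = P^T *m M *m P.
Proof. by move=> Ms; rewrite !trmx_mul trmxK Ms mulmxA. Qed.

Lemma qform_gram n p (P : 'M[R]_(n, p)) u :
  qform (P *m P^T) u = dot (P^T *m u) (P^T *m u).
Proof. by rewrite qformE dot_mulmxl trmxK mulmxA. Qed.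

End DotProduct.

(** * Definite and semidefinite matrices *)

Section Definiteness.
Context {R : realFieldType}.

Definition posdef n (M : 'M[R]_n) := forall x : 'cV[R]_n, x != 0 -> 0 < qform M x.

Lemma negdefP n (M : 'M[R]_n) : M^T = M -> negdef M <-> posdef (- M).
Proof.
move=> Ms; split=> [[_ Mn] x x0|Mp]; first by rewrite qformN oppr_gt0 Mn.
by split=> // x x0; rewrite -oppr_gt0 -qformN Mp.
Qed.

Lemma posdef_ge0 n (M : 'M[R]_n) x : posdef M -> 0 <= qform M x.
Proof.
by move=> Mp; have [->|/Mp/ltW//] := eqVneq x 0; rewrite qform0.
Qed.

Lemma mxrank_inj n p (P : 'M[R]_(n, p)) :
  (forall u : 'cV[R]_p, P *m u = 0 -> u = 0) -> \rank P = p.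
Proof.
move=> Pinj; rewrite -mxrank_tr; apply/eqP/inj_row_free => v vP.
apply: trmx_inj; rewrite trmx0; apply: Pinj.
by rewrite -[P]trmxK -trmx_mul vP trmx0.
Qed.

Lemma unitmx_inj n (M : 'M[R]_n) :
  (forall u : 'cV[R]_n, M *m u = 0 -> u = 0) -> M \in unitmx.
Proof. by move/mxrank_inj => Mr; rewrite -row_free_unit /row_free Mr. Qed.

Lemma posdef_inj n (M : 'M[R]_n) (u : 'cV[R]_n) : posdef M -> M *m u = 0 -> u = 0.
Proof.
move=> Mp Mu; apply/eqP/negP => /negP/Mp.
by rewrite qformE Mu dot0r ltxx.
Qed.

Lemma posdef_unitmx n (M : 'M[R]_n) : posdef M -> M \in unitmx.
Proof. by move=> Mp; apply: unitmx_inj => u; exact: posdef_inj. Qed.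

Lemma negdef_unitmx n (M : 'M[R]_n) : negdef M -> M \in unitmx.
Proof.
move=> [_ Mn]; apply: unitmx_inj => u Mu; apply/eqP/negP => /negP/Mn.
by rewrite qformE Mu dot0r ltxx.
Qed.

(** If x^T M x = 0 and w = M x were nonzero, a small move from x along -w would make the form
    negative. So M x = 0, and invertibility gives x = 0. *)
Lemma psd_posdef n (M : 'M[R]_n) : M^T = M -> (forall x, 0 <= qform M x) ->
  M \in unitmx -> posdef M.
Proof.
move=> Ms M0 Mu x x0; rewrite lt0r M0 andbT.
apply: contra_neq x0 => qx; suff : M *m x = 0.
  by move=> /(congr1 (mulmx (invmx M))); rewrite mulKmx // mulmx0.
set w := M *m x; apply/eqP; rewrite -dot_eq0 eq_le dot_ge0 andbT.
rewrite leNgt; apply/negP => w0.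
(* After a step of length t |w|^2 along -w the form equals t |w|^4 (t c - 2), and this t keeps t c
   below 1. *)
pose c := qform M w; pose t := (1 + c)^-1.
have c1 : 0 < 1 + c by have := M0 w; rewrite -/c; lra.
have t0 : 0 < t by rewrite invr_gt0.
have := M0 (x - (t * dot w w) *: w).
have -> : qform M (x - (t * dot w w) *: w) =
    qform M x - 2 * (t * dot w w) * dot w w + (t * dot w w) ^+ 2 * c.
  have wE : dot x (M *m w) = dot w w by rewrite dot_mulmxr Ms.
  rewrite /c !qformE mulmxBr -scalemxAr -/w !(dotDl, dotDr, dotNl, dotNr, dotZl, dotZr) wE.
  by rewrite (dotC x); ring.
rewrite qx add0r leNgt => /negP; apply.
rewrite [X in X < _](_ : _ = (t * dot w w ^+ 2) * (t * c - 2)); last by ring.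
rewrite pmulr_rlt0 ?mulr_gt0 ?exprn_gt0 // subr_lt0.
rewrite /t mulrC ltr_pdivrMr //; have := M0 w; rewrite -/c; lra.
Qed.

Lemma psd_negdef p (M : 'M[R]_p) : M^T = M -> (forall h, qform M h <= 0) ->
  M \in unitmx -> negdef M.
Proof.
move=> Ms M0 Mu; apply/negdefP => //; apply: psd_posdef.
- by rewrite linearN /= Ms.
- by move=> h; rewrite qformN oppr_ge0.
- by rewrite unitmxE -scaleN1r detZ unitrM -unitmxE Mu unitrX // unitrN1.
Qed.

(** An explicit constant replaces compactness of the sphere: with w_i = M^-1 e_i, the coordinate x_i
    is the M-inner product of x and w_i, so x_i^2 <= (x^T M x) (w_i^T M w_i), to be summed over
    i. *)
Lemma posdef_coercive n (M : 'M[R]_n) : M^T = M -> posdef M ->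
  exists2 c, 0 < c & forall x, c * dot x x <= qform M x.
Proof.
move=> Ms Mp; have Mu := posdef_unitmx Mp.
pose w (i : 'I_n) : 'cV[R]_n := invmx M *m delta_mx i 0.
pose q := 1 + \sum_i qform M (w i).
have S0 : 0 <= \sum_i qform M (w i).
  by apply: sumr_ge0 => i _; apply: posdef_ge0.
have q0 : 0 < q by rewrite ltr_pwDl.
have Mw i : M *m w i = delta_mx i 0 by rewrite mulKVmx.
have w0 i : 0 < qform M (w i).
  apply: Mp; apply/negP => /eqP wi; have := Mw i; rewrite wi mulmx0.
  by move/matrixP/(_ i 0); rewrite !mxE !eqxx => /eqP; rewrite eq_sym oner_eq0.
(* Cauchy-Schwarz for the inner product defined by M *)
have xw (x : 'cV[R]_n) i : x i 0 * x i 0 <= qform M x * qform M (w i).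
  have := posdef_ge0 (x - (x i 0 / qform M (w i)) *: w i) Mp.
  rewrite [qform M (x - _)]qformE mulmxBr -scalemxAr.
  rewrite !(dotDl, dotDr, dotNl, dotNr, dotZl, dotZr) -!qformE Mw dot_delta.
  have -> : dot (w i) (M *m x) = x i 0 by rewrite dot_mulmxr Ms Mw dotC dot_delta.
  rewrite [X in 0 <= X](_ : _ = qform M x - x i 0 * x i 0 / qform M (w i)).
    by rewrite subr_ge0 ler_pdivrMr.
  by field; rewrite gt_eqF.
exists q^-1 => [|x]; first by rewrite invr_gt0.
rewrite mulrC ler_pdivrMr // dotE.
apply: (@le_trans _ _ (\sum_i qform M x * qform M (w i))).
  by apply: ler_sum.
by rewrite -mulr_sumr /q mulrDr mulr1 lerDr posdef_ge0.
Qed.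

End Definiteness.

(** * The primal and dual Hessians as Schur complements *)

Section HessianPair.
Context {R : realFieldType} {n m : nat}.
Implicit Types (G : 'M[R]_n) (F : 'M[R]_(n, m)).

(** For invertible G, [hessP] and [hessD] are the Schur complements of the blocks -1 and G in the
    block matrix with rows (G, F) and (F^T, -1). *)
Definition hessP G F : 'M[R]_n := G + F *m F^T.
Definition hessD G F : 'M[R]_m := - (1%:M + F^T *m invmx G *m F).

Lemma hessP_sym G F : G^T = G -> (hessP G F)^T = hessP G F.
Proof. by move=> Gs; rewrite linearD /= trmx_mul trmxK Gs. Qed.

Lemma hessD_sym G F : G^T = G -> (hessD G F)^T = hessD G F.
Proof.
by move=> Gs; rewrite linearN linearD /= trmx1 !trmx_mul trmxK trmx_inv Gs mulmxA.
Qed.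

Lemma qform_hessP G F h :
  qform (hessP G F) h = qform G h + dot (F^T *m h) (F^T *m h).
Proof. by rewrite qformD qform_gram. Qed.

Lemma qform_hessD G F u :
  qform (hessD G F) u = - (dot u u + qform (invmx G) (F *m u)).
Proof. by rewrite qformN qformD qform_mulmx (qformE 1%:M) mul1mx. Qed.

(** For u in the kernel of [hessD], h = G^-1 F u satisfies F^T h = -u, so [hessP] maps h to F u - F
    u = 0. *)
Lemma hessD_unitmx G F : G \in unitmx -> hessP G F \in unitmx -> hessD G F \in unitmx.
Proof.
move=> Gu Pu; apply: unitmx_inj => u.
rewrite mulNmx => /eqP; rewrite oppr_eq0 mulmxDl mul1mx => /eqP Du.
pose h := invmx G *m (F *m u).
have h0 : h = 0.
  suff : hessP G F *m h = 0.
    by move=> /(congr1 (mulmx (invmx (hessP G F)))); rewrite mulKmx // mulmx0.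
  rewrite mulmxDl mulKVmx // -mulmxA -mulmxDr /h.
  by rewrite !mulmxA Du mulmx0.
by move: Du; rewrite -!mulmxA -/h h0 mulmx0 addr0.
Qed.

(** The form of [hessD] at u is compared with that of [hessP] at G^-1 F u, and the form of [hessP]
    at h with that of [hessD] at F^T h; in each case a square bridges the two. *)
Lemma hessP_hessD_negdef G F :
  negdef G -> negdef (hessP G F) <-> negdef (hessD G F).
Proof.
move=> Gneg; have Gu := negdef_unitmx Gneg; case: (Gneg) => Gs Gn.
have Gp : posdef (- G) by apply/negdefP.
split=> -[_ Hn]; split=> [|u u0]; rewrite ?hessP_sym ?hessD_sym //.
  rewrite qform_hessD oppr_lt0; pose h := invmx G *m (F *m u).
  have GiE : qform (invmx G) (F *m u) = qform G h.
    by rewrite !qformE -/h /h mulKVmx // dotC.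
  have hF : dot (F^T *m h) u = qform G h.
    by rewrite dot_mulmxl trmxK qformE /h mulKVmx.
  rewrite GiE; have [h0|h0] := eqVneq h 0.
    by rewrite h0 qform0 addr0 dot_gt0.
  have := Hn _ h0; rewrite qform_hessP => Hh.
  (* Expanded, this says |u|^2 + h^T G h >= -(h^T G h + |F^T h|^2), and the right side is positive
     by [Hh]. *)
  have := dot_ge0 (u + F^T *m h).
  rewrite !(dotDl, dotDr) (dotC u (F^T *m h)) hF; lra.
set h := u in u0 *; pose v := F^T *m h; rewrite qform_hessP -/v.
have [v0|v0] := eqVneq v 0; first by rewrite v0 dot0r addr0 Gn.
have := Hn _ v0; rewrite qform_hessD oppr_lt0 => Hv.
pose k := invmx G *m (F *m v).
(* Expanded, this bounds h^T G h + |v|^2 by -(|v|^2 + v^T F^T G^-1 F v), which is negative by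
   [Hv]. *)
have : 0 <= qform (- G) (h + k) by apply: posdef_ge0.
rewrite qformN qformE mulmxDr /k mulKVmx // -/k !(dotDl, dotDr).
have -> : dot k (G *m h) = dot v v.
  by rewrite dot_mulmxr Gs /k mulKVmx // dot_mulmxl.
have -> : dot h (F *m v) = dot v v by rewrite dot_mulmxr.
have -> : dot k (F *m v) = qform (invmx G) (F *m v) by rewrite qformE dotC.
rewrite -qformE; lra.
Qed.

(** Both sides equal W + W^2 for W = F^T G^-1 F, as [hessD] is -(1 + W). *)
Lemma congr_hessP G F : G^T = G -> G \in unitmx ->
  (invmx G *m F)^T *m hessP G F *m (invmx G *m F) =
  hessD G F *m hessD G F + hessD G F.
Proof.
move=> Gs Gu; set W := F^T *m invmx G *m F.
have -> : hessD G F = - (1%:M + W) by [].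
rewrite mulNmx mulmxN opprK mulmxDl mul1mx [X in X - _]addrC addrK (mulmxDr W) mulmx1.
rewrite trmx_mul trmx_inv Gs /hessP mulmxDr mulmxDl.
by congr (_ + _); rewrite /W !mulmxA ?mulmxKV.
Qed.

(** Substitute F F^T = H - G, with H for [hessP G F], in -(F F^T + F F^T G^-1 F F^T). *)
Lemma congr_hessD G F : G^T = G -> G \in unitmx ->
  F *m hessD G F *m F^T = hessP G F - hessP G F *m invmx G *m hessP G F.
Proof.
move=> Gs Gu; have -> : F *m hessD G F *m F^T =
    - (F *m F^T + F *m F^T *m invmx G *m (F *m F^T)).
  by rewrite /hessD mulmxN mulNmx mulmxDr mulmxDl mulmx1 !mulmxA.
rewrite /hessP; set K := F *m F^T.
rewrite (mulmxDl G) mulmxV // (mulmxDl 1%:M) mul1mx (mulmxDr (K *m _)) mulmxKV //.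
by rewrite [in RHS]opprD addrA subrr sub0r.
Qed.

Lemma congr_hessP_posdef G F : G^T = G -> G \in unitmx -> posdef (hessD G F) ->
  posdef ((invmx G *m F)^T *m hessP G F *m (invmx G *m F)).
Proof.
move=> Gs Gu Dp u u0; rewrite congr_hessP // qformD ltr_wpDl ?Dp //.
by rewrite qformE -mulmxA dot_mulmxr hessD_sym // dot_ge0.
Qed.

(** The term -H G^-1 H only adds to H, since G^-1 is negative definite along with G. *)
Lemma congr_hessD_posdef G F : negdef G -> posdef (hessP G F) ->
  posdef (F *m hessD G F *m F^T).
Proof.
move=> Gneg Pp u u0; have Gu := negdef_unitmx Gneg; case: (Gneg) => Gs Gn.
have Gp : posdef (- G) by apply/negdefP.
rewrite congr_hessD // qformD qformN ltr_wpDr ?Pp // oppr_ge0.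
have -> : qform (hessP G F *m invmx G *m hessP G F) u =
    qform (invmx G) (hessP G F *m u) by rewrite qform_mulmx hessP_sym.
set v := hessP G F *m u; rewrite qformE -[X in dot X _](mulKVmx Gu v) dotC -qformE.
by rewrite -oppr_ge0 -qformN posdef_ge0.
Qed.

(** On the kernel of G^-1 F, [hessD] acts as -1. *)
Lemma rank_hessD_posdef G F : posdef (hessD G F) -> \rank (invmx G *m F) = m.
Proof.
move=> Dp; apply: mxrank_inj => u; rewrite -mulmxA => Pu; apply/eqP/negP => /negP u0.
have := Dp _ u0; rewrite qformE /hessD mulNmx mulmxDl mul1mx -!mulmxA Pu mulmx0.
by rewrite addr0 dotNr oppr_gt0 ltNge dot_ge0.
Qed.

(** On the kernel of F^T, the form of [hessP] is that of G. *)
Lemma rank_hessP_posdef G F : negdef G -> posdef (hessP G F) -> \rank F^T = n.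
Proof.
move=> [_ Gn] Pp; apply: mxrank_inj => u Fu; apply/eqP/negP => /negP u0.
have := Pp _ u0; rewrite qform_hessP Fu dot0r addr0.
by rewrite ltNge => /negP; apply; apply/ltW/Gn.
Qed.

End HessianPair.

Lemma exists_kernel (R : realFieldType) p q (M : 'M[R]_(p, q)) : (p < q)%N ->
  exists2 u : 'cV[R]_q, u != 0 & M *m u = 0.
Proof.
move=> pq; have K0 : kermx M^T != 0.
  rewrite kermx_eq0 /row_free mxrank_tr; apply/eqP => Mr.
  by have := rank_leq_row M; rewrite Mr leqNgt pq.
have /rowV0Pn[v /sub_kermxP vM v0] := K0; exists v^T.
  by apply: contra v0 => /eqP v0; rewrite -[v]trmxK v0 trmx0.
by rewrite -[M]trmxK -trmx_mul vM trmx0.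
Qed.

(** * Convergence of matrices *)

Section MatrixConvergence.
Context {R : realType} {T : Type} {F : set_system T} {FF : Filter F}.

Lemma cvg_sumr (I : Type) (r : seq I) (P : pred I) (V : normedModType R)
    (g : I -> T -> V) (l : I -> V) :
  (forall i, P i -> g i t @[t --> F] --> l i) ->
  \sum_(i <- r | P i) g i t @[t --> F] --> \sum_(i <- r | P i) l i.
Proof. by apply: cvg_big => //; exact: add_continuous. Qed.

Lemma cvg_prodr (I : Type) (r : seq I) (P : pred I) (g : I -> T -> R) (l : I -> R) :
  (forall i, P i -> g i t @[t --> F] --> l i) ->
  \prod_(i <- r | P i) g i t @[t --> F] --> \prod_(i <- r | P i) l i.
Proof. by apply: cvg_big => //; exact: mul_continuous. Qed.

Lemma cvg_mx n p (M : T -> 'M[R]_(n, p)) (A : 'M[R]_(n, p)) :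
  (forall i j, M t i j @[t --> F] --> A i j) -> M t @[t --> F] --> A.
Proof.
move=> cM Q [P AP PQ].
have : \forall t \near F, forall ij : 'I_n * 'I_p, P ij.1 ij.2 (M t ij.1 ij.2).
  by apply: filter_forall => -[i j]; apply: cM.
by apply: filterS => t Pt; apply: PQ => i j; exact: (Pt (i, j)).
Qed.

Lemma cvg_coord n p (M : T -> 'M[R]_(n, p)) (A : 'M[R]_(n, p)) i j :
  M t @[t --> F] --> A -> M t i j @[t --> F] --> A i j.
Proof. move=> cM.
exact: (cvg_comp M (fun N : 'M[R]_(n, p) => N i j) cM (@coord_continuous R n p i j A)). Qed.

Lemma cvg_mulmx n p q (M : T -> 'M[R]_(n, p)) (N : T -> 'M[R]_(p, q))
    (A : 'M[R]_(n, p)) (B : 'M[R]_(p, q)) :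
  M t @[t --> F] --> A -> N t @[t --> F] --> B ->
  M t *m N t @[t --> F] --> A *m B.
Proof.
move=> cM cN; apply: cvg_mx => i j; rewrite mxE.
under eq_cvg do rewrite mxE.
by apply: cvg_sumr => k _; apply: cvgM; apply: cvg_coord.
Qed.

Lemma cvg_trmx n p (M : T -> 'M[R]_(n, p)) (A : 'M[R]_(n, p)) :
  M t @[t --> F] --> A -> (M t)^T @[t --> F] --> A^T.
Proof.
move=> cM; apply: cvg_mx => i j; rewrite mxE.
by under eq_cvg do rewrite mxE; apply: cvg_coord.
Qed.

Lemma cvg_det n (M : T -> 'M[R]_n) (A : 'M[R]_n) :
  M t @[t --> F] --> A -> \det (M t) @[t --> F] --> \det A.
Proof.
move=> cM; apply: cvg_sumr => s _; apply: cvgM; first exact: cvg_cst.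
by apply: cvg_prodr => i _; apply: cvg_coord.
Qed.

Lemma cvg_adjugate n (M : T -> 'M[R]_n) (A : 'M[R]_n) :
  M t @[t --> F] --> A -> \adj (M t) @[t --> F] --> \adj A.
Proof.
move=> cM; apply: cvg_mx => i j; rewrite mxE; under eq_cvg do rewrite mxE.
apply: cvgM; first exact: cvg_cst.
apply: cvg_det; apply: cvg_mx => k l; rewrite !mxE.
by under eq_cvg do rewrite !mxE; apply: cvg_coord.
Qed.

Lemma cvg_invmx n (M : T -> 'M[R]_n) (A : 'M[R]_n) : A \in unitmx ->
  M t @[t --> F] --> A -> invmx (M t) @[t --> F] --> invmx A.
Proof.
move=> Au cM; have dA : \det A != 0 by rewrite -unitfE -unitmxE.
have dM := cvg_det cM; rewrite {2}/invmx Au.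
apply: cvg_trans (cvgZ (cvgV dA dM) (cvg_adjugate cM)).
(* [invmx] returns a singular matrix unchanged, so the adjugate formula holds only where the
   determinant is nonzero, which is eventually the case. *)
apply: near_eq_cvg; near=> t; rewrite /invmx /= unitmxE unitfE ifT //.
by near: t; exact: cvgr_neq0 dM dA.
Unshelve. all: by end_near. Qed.

Lemma cvg_qform n (M : T -> 'M[R]_n) (u : T -> 'cV[R]_n)
    (A : 'M[R]_n) (a : 'cV[R]_n) :
  M t @[t --> F] --> A -> u t @[t --> F] --> a ->
  qform (M t) (u t) @[t --> F] --> qform A a.
Proof.
by move=> cM cu; apply/cvg_coord/cvg_mulmx => //; apply/cvg_mulmx/cM/cvg_trmx.
Qed.

(** Each term is at most e (x_i^2 + x_j^2) / 2; summing over both indices gives the factor n. *)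
Lemma normr_qform_le n (M : 'M[R]_n) e x : (forall i j, `|M i j| <= e) ->
  `|qform M x| <= n%:R * e * dot x x.
Proof.
move=> Me.
have -> : qform M x = \sum_i \sum_j x i 0 * M i j * x j 0.
  rewrite qformE dotE; apply: eq_bigr => i _; rewrite mxE mulr_sumr.
  by apply: eq_bigr => j _; rewrite mulrA.
apply: (@le_trans _ _ (\sum_(i < n) \sum_(j < n)
    (e / 2 * (x i 0 * x i 0) + e / 2 * (x j 0 * x j 0)))).
  apply: le_trans (ler_norm_sum _ _ _) _; apply: ler_sum => i _.
  apply: le_trans (ler_norm_sum _ _ _) _; apply: ler_sum => j _.
  rewrite !normrM -!expr2 -[in leRHS](real_normK (num_real (x i 0))) -[in leRHS](real_normK (num_real (x j 0))).
  have := Me i j; have := normr_ge0 (M i j).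
  set a := `|x i 0|; set b := `|x j 0| => M0 Mle.
  have := normr_ge0 (x i 0); have := normr_ge0 (x j 0); rewrite -/a -/b => b0 a0.
  apply: (@le_trans _ _ (a * e * b)); first by rewrite ler_wpM2r // ler_wpM2l.
  have := mulr_ge0 (le_trans M0 Mle) (sqr_ge0 (a - b)); nra.
rewrite (eq_bigr (fun i => n%:R * (e / 2 * (x i 0 * x i 0)) + e / 2 * dot x x)).
  rewrite big_split /= sumr_const card_ord -!mulr_sumr -dotE -mulr_natl.
  by rewrite le_eqVlt; apply/orP; left; apply/eqP; field.
by move=> i _; rewrite big_split /= sumr_const card_ord mulr_natl dotE mulr_sumr.
Qed.

Lemma near_posdef n (M : T -> 'M[R]_n) (A : 'M[R]_n) : A^T = A -> posdef A ->
  M t @[t --> F] --> A -> \forall t \near F, posdef (M t).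
Proof.
move=> As Ap cM; have [c c0 Ac] := posdef_coercive As Ap.
(* This makes n e < c, so the perturbation cannot outweigh the coercivity constant; the summand 1
   covers n = 0. *)
pose e := c / (n%:R + 1).
have n1 : (0 : R) < n%:R + 1 by rewrite ltr_wpDl.
have e0 : 0 < e by rewrite divr_gt0.
have : \forall t \near F, forall ij : 'I_n * 'I_n,
    `|M t ij.1 ij.2 - A ij.1 ij.2| <= e.
  apply: filter_forall => -[i j] /=.
  by apply: cvgr_distC_le e0; exact: cvg_coord.
apply: filterS => t Mt x x0.
have -> : M t = A + (M t - A) by rewrite addrC subrK.
have xx : 0 < dot x x by rewrite dot_gt0.
rewrite qformD; have := Ac x.
have : `|qform (M t - A) x| <= n%:R * e * dot x x.
  by apply: normr_qform_le => i j; have := Mt (i, j); rewrite !mxE.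
rewrite ler_norml => /andP[Dx _] Ax.
have : n%:R * e * dot x x < c * dot x x.
  by rewrite ltr_pM2r // /e mulrCA gtr_pMr // ltr_pdivrMr // mul1r ltrDl.
lra.
Qed.

End MatrixConvergence.

(** * Second-order expansions and local extrema *)

Section SecondOrder.
Context {R : realType}.

Lemma cvg_line n (x h : 'cV[R]_n) : x + t *: h @[t --> (0 : R)] --> x.
Proof.
have : x + t *: h @[t --> (0 : R)] --> x + (0 : R) *: h.
  by apply: cvgD; [exact: cvg_cst|apply: cvgZ; [exact: cvg_id|exact: cvg_cst]].
by rewrite scale0r addr0.
Qed.

Lemma cvg_line_dnbhs n (x h : 'cV[R]_n) : x + t *: h @[t --> (0 : R)^'] --> x.
Proof. by move=> A /(@cvg_line n x h)/nbhs_dnbhs. Qed.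

(** Caratheodory's form of the derivative: the difference quotient agrees with [phi] for small
    nonzero t. *)
Lemma derive_carath n (g : 'cV[R]_n -> R) x v (phi : R -> R) (l : R) :
  (\forall t \near (0 : R)^', g (x + t *: v) - g x = t * phi t) ->
  phi t @[t --> (0 : R)^'] --> l -> 'D_v g x = l.
Proof.
move=> gE cphi; apply/cvg_lim => //; apply: cvg_trans cphi.
apply: near_eq_cvg; near=> t; rewrite /= [_ *: v + x]addrC.
rewrite (near gE t) // -[LHS]mul1r -(@mulVf _ t); last first.
  by near: t; exact: nbhs_dnbhs_neq.
by rewrite -mulrA.
Unshelve. all: by end_near. Qed.

Lemma derive_expansion n (g : 'cV[R]_n -> R) x v (a : R) (phi : R -> R) (l : R) :
  (\forall t \near (0 : R)^', g (x + t *: v) - g x = t * (a + t * phi t)) ->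
  phi t @[t --> (0 : R)^'] --> l -> 'D_v g x = a.
Proof.
move=> gE cphi; apply: (derive_carath gE).
have : a + t * phi t @[t --> (0 : R)^'] --> a + 0 * l.
  apply: cvgD; first exact: cvg_cst.
  by apply: cvgM cphi; exact: nbhs_dnbhs.
by rewrite mul0r addr0.
Qed.

Lemma affine_spanP n p (x : 'cV[R]_n) (P : 'M[R]_(n, p)) y :
  affine_span x P y <-> exists t : 'cV[R]_p, y = x + P *m t.
Proof.
have spanE (t : 'cV[R]_p) : \sum_k t k 0 *: col k P = P *m t.
  apply/matrixP => i j; rewrite summxE mxE; apply: eq_bigr => k _.
  by rewrite !mxE ord1 mulrC.
split=> [[t _ <-]|[t ->]]; first by exists t; rewrite spanE.
by exists t => //; rewrite spanE.
Qed.

(** An exact second-order formula at a critical point: there is no linear term, and the remainder is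
    absorbed by letting the matrix vary continuously with y. *)
Definition has_expansion n (g : 'cV[R]_n -> R) x (H : 'M[R]_n) :=
  exists2 N : 'cV[R]_n -> 'M[R]_n, N y @[y --> x] --> H &
    \forall y \near x, g y - g x = 2^-1 * qform (N y) (y - x).

Lemma has_expansionN n (g : 'cV[R]_n -> R) x H :
  has_expansion g x H -> has_expansion (fun y => - g y) x (- H).
Proof.
move=> [N cN gE]; exists (fun y => - N y); [exact: (cvgN cN)|].
by apply: filterS gE => y gy; rewrite /= qformN mulrN -gy; ring.
Qed.

(** Along x + t h the increment is t^2 / 2 times the form of N(x + t h) at h; drop the positive
    factor and let t tend to 0. *)
Lemma min_expansion n (g : 'cV[R]_n -> R) x H : has_expansion g x H ->
  (\forall y \near x, g x <= g y) -> forall h, 0 <= qform H h.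
Proof.
move=> [N cN gE] gmin h; have cl := @cvg_line_dnbhs n x h.
have cq : qform (N (x + t *: h)) h @[t --> (0 : R)^'] --> qform H h.
  apply: cvg_qform; last exact: cvg_cst.
  by apply: (cvg_comp _ N cl cN).
apply: (cvgr_to_ge cq).
have : \forall t \near (0 : R)^', g (x + t *: h) - g x =
    2^-1 * qform (N (x + t *: h)) (x + t *: h - x) by exact: cl _ gE.
have : \forall t \near (0 : R)^', g x <= g (x + t *: h) by exact: cl _ gmin.
have : \forall t \near (0 : R)^', t != 0 by exact: nbhs_dnbhs_neq.
apply: filterS3 => t t0 gt gtE.
move: gt; rewrite -subr_ge0 gtE [x + _ - x]addrC addKr qformZr mulrA pmulr_rge0 //.
by rewrite mulr_gt0 ?invr_gt0 // exprn_even_gt0.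
Qed.

Lemma max_expansion n (g : 'cV[R]_n -> R) x H : has_expansion g x H ->
  (\forall y \near x, g y <= g x) -> forall h, qform H h <= 0.
Proof.
move=> /has_expansionN gH gmax h; rewrite -oppr_ge0 -qformN.
by apply: (min_expansion gH); apply: filterS gmax => y; rewrite lerN2.
Qed.

(** P^T N(y) P stays positive definite near x, and on the affine span y - x = P t. Definiteness on
    the range of P thus gives a minimum along it. *)
Lemma expansion_min n p (g : 'cV[R]_n -> R) x H (P : 'M[R]_(n, p)) : H^T = H ->
  has_expansion g x H -> posdef (P^T *m H *m P) ->
  \forall y \near x, affine_span x P y -> g x <= g y.
Proof.
move=> Hs [N cN gE] Hp.
have : \forall y \near x, posdef (P^T *m N y *m P).
  apply: (near_posdef (F := nbhs x) (M := fun y => P^T *m N y *m P)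
    (congr_sym P Hs) Hp).
  apply: cvg_mulmx; last exact: cvg_cst.
  by apply: cvg_mulmx => //; exact: cvg_cst.
apply: filterS2 gE => y gy Np /affine_spanP[t yE].
rewrite -subr_ge0 gy {2}yE [x + _ - x]addrC addKr qform_mulmx mulr_ge0 ?invr_ge0 //.
exact: posdef_ge0.
Qed.

Lemma expansion_max n (g : 'cV[R]_n -> R) x H :
  has_expansion g x H -> negdef H -> \forall y \near x, g y <= g x.
Proof.
move=> /has_expansionN gH [Hs Hn].
have : \forall y \near x, affine_span x (1%:M : 'M[R]_n) y -> - g x <= - g y.
  apply: expansion_min gH _; first by rewrite linearN /= Hs.
  by rewrite trmx1 mul1mx mulmx1; apply/negdefP.
apply: filterS => y; rewrite lerN2; apply; apply/affine_spanP; exists (y - x).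
by rewrite mul1mx addrC subrK.
Qed.

End SecondOrder.

(** * Primal and dual functions *)

(** The transpose solves the same Penrose equations, whose solution is unique. *)
Lemma mpinvmx_sym (R : realFieldType) n (M : 'M[R]_n) : M^T = M ->
  (mpinvmx M)^T = mpinvmx M.
Proof.
move=> Ms; apply: (penrose_uniq (A := M)); last exact: penrose_mpinvmx.
move: (mpinvmx M) (penrose_mpinvmx M) => X [MXM XMX MXt XMt]; split.
- by apply: trmx_inj; rewrite !trmx_mul trmxK Ms mulmxA MXM.
- by apply: trmx_inj; rewrite !trmx_mul trmxK Ms mulmxA XMX.
- by rewrite trmx_mul trmxK Ms -[LHS]XMt trmx_mul Ms.
- by rewrite trmx_mul trmxK Ms -[LHS]MXt trmx_mul Ms.
Qed.

Section PrimalDual.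
Context {R : realType} {n m : nat}.
Context (A : 'M[R]_n) (B : 'I_m -> 'M[R]_n) (f : 'cV[R]_n) (d : 'cV[R]_m).
Hypotheses (A_sym : A^T = A) (B_sym : forall k, (B k)^T = B k).

Local Notation Pi := (primal A B f d).
Local Notation Pid := (dual A B f d).
Local Notation G := (Gmx A B).

(** Its transpose is the Jacobian of [multiplier] at x. *)
Definition Bmx (x : 'cV[R]_n) : 'M[R]_(n, m) := \matrix_(i, k) (B k *m x) i 0.

Definition multiplier (x : 'cV[R]_n) : 'cV[R]_m :=
  \col_k (2^-1 * qform (B k) x - d k 0).

Definition dual_sol (s : 'cV[R]_m) : 'cV[R]_n := mpinvmx (G s) *m f.

Definition primal_grad (x : 'cV[R]_n) : 'cV[R]_n := G (multiplier x) *m x - f.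

Lemma Gmx_sym s : (G s)^T = G s.
Proof.
rewrite /Gmx linearD /= A_sym linear_sum; congr (_ + _).
by apply: eq_bigr => k _; rewrite linearZ /= B_sym.
Qed.

Lemma Bmx_mul x (s : 'cV[R]_m) : Bmx x *m s = (\sum_k s k 0 *: B k) *m x.
Proof.
apply/matrixP => i j; rewrite ord1 mulmx_suml summxE mxE.
by apply: eq_bigr => k _; rewrite -scalemxAl !mxE mulrC.
Qed.

Lemma Gmx_mulmx s x : G s *m x = A *m x + Bmx x *m s.
Proof. by rewrite mulmxDl Bmx_mul. Qed.

Lemma BmxC x y s : dot y (Bmx x *m s) = dot x (Bmx y *m s).
Proof.
rewrite !Bmx_mul [RHS]dotC dot_mulmxl; congr (dot _ (_ *m _)).
by rewrite linear_sum; apply: eq_bigr => k _; rewrite linearZ /= B_sym.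
Qed.

Lemma BmxD x y : Bmx (x + y) = Bmx x + Bmx y.
Proof. by apply/matrixP => i k; rewrite [RHS]mxE ![Bmx _ _ _]mxE mulmxDr mxE. Qed.

Lemma BmxZ a x : Bmx (a *: x) = a *: Bmx x.
Proof. by apply/matrixP => i k; rewrite [RHS]mxE ![Bmx _ _ _]mxE -scalemxAr mxE. Qed.

Lemma multiplierE x : multiplier x = 2^-1 *: ((Bmx x)^T *m x) - d.
Proof.
apply/matrixP => k j; rewrite ord1 !mxE; congr (_ * _ - _).
rewrite qformE dotC dotE; by apply: eq_bigr => i _; rewrite !mxE.
Qed.

(** The increment of a quadratic map is its Jacobian at the midpoint applied to the displacement.
    This is where the midpoints below come from. *)
Lemma multiplierB x y :
  multiplier y - multiplier x = (Bmx (2^-1 *: (x + y)))^T *m (y - x).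
Proof.
have BtC u v : (Bmx u)^T *m v = (Bmx v)^T *m u.
  apply/matrixP => k j; rewrite ord1.
  have := BmxC u v (delta_mx k 0).
  by rewrite !dot_mulmxr !dot_delta => ->.
have -> : (Bmx (2^-1 *: (x + y)))^T = 2^-1 *: ((Bmx x)^T + (Bmx y)^T).
  by rewrite BmxZ BmxD linearZ linearD.
rewrite !multiplierE -scalemxAl mulmxDl !mulmxBr (BtC y x) opprB addrA subrK.
by rewrite -scalerBr; congr (_ *: _); rewrite [RHS]addrC addrA subrK.
Qed.

Lemma primalE x : Pi x =
  2^-1 * dot (multiplier x) (multiplier x) + 2^-1 * qform A x - dot x f.
Proof.
rewrite /primal dotE; congr (_ * _ + _ - _).
by apply: eq_bigr => k _; rewrite mxE expr2.
Qed.

(** In the square of s + K^T h the cross term has a part linear in h, which joins the gradient, and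
    a quadratic part, which turns A into G(s); |K^T h|^2 is the form of K K^T. *)
Lemma primal_expansion x y : Pi y - Pi x = dot (primal_grad x) (y - x) +
  2^-1 * qform (hessP (G (multiplier x)) (Bmx (2^-1 *: (x + y)))) (y - x).
Proof.
set K := Bmx _; set h := y - x.
have yE : y = x + h by rewrite addrC subrK.
have sE : multiplier y = multiplier x + K^T *m h by rewrite -multiplierB addrC subrK.
clearbody h; subst y; rewrite !primalE sE qform_hessP; set s := multiplier x; set v := K^T *m h.
have vE : dot s v = dot h (Bmx x *m s) + 2^-1 * dot h (Bmx h *m s).
  rewrite /v -dot_mulmxl dotC /K BmxZ !BmxD -scalemxAl !mulmxDl.
  by rewrite dotZr !dotDr; lra.
have AE : dot x (A *m h) = dot h (A *m x) by rewrite dot_mulmxr A_sym dotC.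
rewrite /primal_grad -/s !qformE !Gmx_mulmx mulmxDr.
rewrite !(dotDl, dotDr, dotNl, dotNr) (dotC v s) vE AE.
rewrite (dotC (A *m x) h) (dotC (Bmx x *m s)) (dotC f h); lra.
Qed.

(** With s, s' the multipliers of x, y: G(s') y - G(s) x = G(s') (y - x) + (G(s') - G(s)) x, and the
    last term is [Bmx x] applied to s' - s. *)
Lemma primal_gradB x y : primal_grad y - primal_grad x =
  (G (multiplier y) + Bmx x *m (Bmx (2^-1 *: (x + y)))^T) *m (y - x).
Proof.
rewrite mulmxDl -mulmxA -multiplierB (mulmxBr (G _)) (mulmxBr (Bmx x)) /primal_grad.
rewrite (Gmx_mulmx _ x) (Gmx_mulmx (multiplier y) x).
move: (G _ *m y) (A *m x) (Bmx x *m _) (Bmx x *m _) => u v w z.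
by apply/matrixP => i j; rewrite !mxE; ring.
Qed.

(** Any solution z of G(s) z = f serves, because the generalized inverse enters only through f^T G^+
    f = z^T G z. The squares are then completed with x^T G(s) x = x^T A x + 2 s^T (xi(x) + d). *)
Lemma primal_dual_gap x s z : f = G s *m z -> Pi x - Pid s =
  2^-1 * dot (multiplier x - s) (multiplier x - s) + 2^-1 * qform (G s) (x - z).
Proof.
move=> fE; rewrite primalE /dual.
have -> : qform (mpinvmx (G s)) f = dot z (G s *m z).
  have [GXG _ _ _] := penrose_mpinvmx (G s).
  by rewrite qformE {1}fE dot_mulmxl Gmx_sym fE 2!mulmxA GXG.
rewrite -/(dot s s) -/(dot s d) [qform (G s) _]qformE mulmxBr.
have zx : dot z (G s *m x) = dot x (G s *m z) by rewrite dot_mulmxr Gmx_sym dotC.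
have xx : dot x (G s *m x) = qform A x + 2 * (dot s (multiplier x) + dot s d).
  rewrite Gmx_mulmx dotDr -qformE multiplierE dotDr dotNr dotZr subrK.
  by rewrite dot_mulmxr dotC dot_mulmxr; lra.
rewrite !(dotDl, dotDr, dotNl, dotNr) zx xx -fE (dotC (multiplier x) s); lra.
Qed.

(** Hence a dual critical point is the multiplier of its own primal point. *)
Lemma dual_gradientE s : dual_gradient A B f d s = multiplier (dual_sol s) - s.
Proof.
apply/matrixP => k j; rewrite ord1 [LHS]mxE [RHS]mxE [multiplier _ _ _]mxE [(- s) _ _]mxE addrAC.
congr (_ * _ - _ - _); rewrite /qform /dual_sol trmx_mul mpinvmx_sym ?Gmx_sym //.
by rewrite !mulmxA.
Qed.

Lemma dual_solE s : Sa A B f s -> f = G s *m dual_sol s.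
Proof.
rewrite /dual_sol => -[y fE].
move: (mpinvmx _) (penrose_mpinvmx (G s)) => X [GXG _ _ _].
by rewrite fE !mulmxA GXG.
Qed.

Lemma Sa_unitmx s : G s \in unitmx -> Sa A B f s.
Proof. by move=> Gu; exists (invmx (G s) *m f); rewrite mulKVmx. Qed.

(** A resolvent identity, obtained by comparing the two linear systems with common right-hand side
    f. *)
Lemma dual_solB s r : G s \in unitmx -> G r \in unitmx ->
  dual_sol r - dual_sol s = - (invmx (G r) *m (Bmx (dual_sol s) *m (r - s))).
Proof.
move=> Gs Gr; have fs := dual_solE (Sa_unitmx Gs); have fr := dual_solE (Sa_unitmx Gr).
apply: (can_inj (mulKmx Gr)); rewrite mulmxN mulKVmx // mulmxBr -fr {1}fs.
by rewrite !Gmx_mulmx opprD addrACA subrr add0r -mulmxBr -mulmxN opprB.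
Qed.

Lemma dual_gradientB s r : G s \in unitmx -> G r \in unitmx ->
  dual_gradient A B f d r - dual_gradient A B f d s =
  - ((Bmx (2^-1 *: (dual_sol s + dual_sol r)))^T *m
     (invmx (G r) *m Bmx (dual_sol s)) + 1%:M) *m (r - s).
Proof.
move=> Gs Gr; rewrite !dual_gradientE mulNmx mulmxDl mul1mx -!mulmxA !opprD -mulmxN -dual_solB // -multiplierB.
move: (multiplier _) (multiplier _) => u v.
by apply/matrixP => i j; rewrite !mxE; ring.
Qed.

(** Both dual values are compared with the primal value at [dual_sol s], which cancels between the
    two gaps. *)
Lemma dual_expansion s r : G s \in unitmx -> G r \in unitmx ->
  Pid r - Pid s = dot (dual_gradient A B f d s) (r - s) +
    2^-1 * qform (hessD (G r) (Bmx (dual_sol s))) (r - s).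
Proof.
move=> Gs Gr; have fs := dual_solE (Sa_unitmx Gs); have fr := dual_solE (Sa_unitmx Gr).
set x := dual_sol s; set h := r - s.
have gs := primal_dual_gap x fs; have gr := primal_dual_gap x fr.
have -> : Pid r - Pid s = (Pi x - Pid s) - (Pi x - Pid r) by ring.
rewrite gs gr dual_gradientE -/x subrr qform0 mulr0 addr0 qform_hessD.
have -> : qform (G r) (x - dual_sol r) = qform (invmx (G r)) (Bmx x *m h).
  rewrite -opprB dual_solB // opprK !qformE mulKVmx //.
  by rewrite dotC.
have -> : multiplier x - r = multiplier x - s - h by rewrite /h opprB addrA subrK.
set q := qform _ _; set w := _ - s; clearbody q w h.
rewrite !(dotDl, dotDr, dotNl, dotNr) (dotC h w); lra.
Qed.

End PrimalDual.

(** * Limits, gradients and Hessians of the two functions *)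

Section Derivatives.
Context {R : realType} {n m : nat}.
Context (A : 'M[R]_n) (B : 'I_m -> 'M[R]_n) (f : 'cV[R]_n) (d : 'cV[R]_m).
Hypotheses (A_sym : A^T = A) (B_sym : forall k, (B k)^T = B k).

Local Notation Pi := (primal A B f d).
Local Notation Pid := (dual A B f d).
Local Notation G := (Gmx A B).
Local Notation mul := (multiplier B d).
Local Notation sol := (dual_sol A B f).
Local Notation pgrad := (primal_grad A B f d).
Local Notation dgrad := (dual_gradient A B f d).

Lemma cvg_Bmx T (F : set_system T) {FF : Filter F} (u : T -> 'cV[R]_n) (a : 'cV[R]_n) :
  u t @[t --> F] --> a -> Bmx B (u t) @[t --> F] --> Bmx B a.
Proof.
move=> cu; apply: cvg_mx => i k; rewrite mxE; under eq_cvg do rewrite mxE.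
by apply: cvg_coord; apply: cvg_mulmx => //; exact: cvg_cst.
Qed.

Lemma cvg_Gmx T (F : set_system T) {FF : Filter F} (s : T -> 'cV[R]_m) (a : 'cV[R]_m) :
  s t @[t --> F] --> a -> G (s t) @[t --> F] --> G a.
Proof.
move=> cs; apply: cvgD; first exact: cvg_cst.
by apply: cvg_sumr => k _; apply: cvgZ; [exact: cvg_coord|exact: cvg_cst].
Qed.

Lemma cvg_multiplier T (F : set_system T) {FF : Filter F}
    (u : T -> 'cV[R]_n) (a : 'cV[R]_n) :
  u t @[t --> F] --> a -> mul (u t) @[t --> F] --> mul a.
Proof.
move=> cu; apply: cvg_mx => k j; rewrite mxE; under eq_cvg do rewrite mxE.
apply: cvgB; last exact: cvg_cst.
apply: cvgM; first exact: cvg_cst.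
by apply: cvg_qform => //; exact: cvg_cst.
Qed.

Lemma cvg_midpoint T (F : set_system T) {FF : Filter F}
    (x : 'cV[R]_n) (u : T -> 'cV[R]_n) :
  u t @[t --> F] --> x -> 2^-1 *: (x + u t) @[t --> F] --> x.
Proof.
move=> cu; rewrite [X in _ --> X](_ : x = 2^-1 *: (x + x)).
  by apply: cvgZ; [exact: cvg_cst|apply: cvgD => //; exact: cvg_cst].
by apply/matrixP => i j; rewrite !mxE; lra.
Qed.

Lemma cvg_hessP_midpoint T (F : set_system T) {FF : Filter F} (K : 'M[R]_n)
    (x : 'cV[R]_n) (u : T -> 'cV[R]_n) : u t @[t --> F] --> x ->
  hessP K (Bmx B (2^-1 *: (x + u t))) @[t --> F] --> hessP K (Bmx B x).
Proof.
move=> cu; have cB : Bmx B (2^-1 *: (x + u t)) @[t --> F] --> Bmx B x.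
  by apply: cvg_Bmx; exact: cvg_midpoint.
by apply: cvgD; [exact: cvg_cst|exact: (cvg_mulmx cB (cvg_trmx cB))].
Qed.

Lemma cvg_hessD T (F : set_system T) {FF : Filter F} (K : 'M[R]_(n, m))
    (s : 'cV[R]_m) (r : T -> 'cV[R]_m) : G s \in unitmx ->
  r t @[t --> F] --> s -> hessD (G (r t)) K @[t --> F] --> hessD (G s) K.
Proof.
move=> Gs cr; apply: cvgN; apply: cvgD; first exact: cvg_cst.
apply: cvg_mulmx; last exact: cvg_cst.
by apply: cvg_mulmx; [exact: cvg_cst|apply: cvg_invmx => //; exact: cvg_Gmx].
Qed.

Lemma near_Gmx_unitmx s : G s \in unitmx -> \forall r \near s, G r \in unitmx.
Proof.
rewrite unitmxE unitfE => Gs.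
have cG : \det (G r) @[r --> s] --> \det (G s).
  exact: (cvg_det (@cvg_Gmx _ (nbhs s) _ id s cvg_id)).
have : \forall r \near s, \det (G r) != 0 by exact: cvgr_neq0 cG Gs.
by apply: filterS => r; rewrite unitmxE unitfE.
Qed.

Lemma cvg_dual_sol T (F : set_system T) {FF : Filter F} (s : 'cV[R]_m)
    (r : T -> 'cV[R]_m) : G s \in unitmx ->
  r t @[t --> F] --> s -> sol (r t) @[t --> F] --> sol s.
Proof.
move=> Gs cr; apply: cvg_mulmx; last exact: cvg_cst.
have -> : mpinvmx (G s) = invmx (G s) by rewrite mpinvmx_unit.
apply: cvg_trans (cvg_invmx Gs (cvg_Gmx cr)); apply: near_eq_cvg.
have : \forall t \near F, G (r t) \in unitmx by exact: cr _ (near_Gmx_unitmx Gs).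
by apply: filterS => t Gt; rewrite mpinvmx_unit.
Qed.

Lemma derive_primal x j : 'D_(delta_mx j 0) Pi x = pgrad x j 0.
Proof.
set e : 'cV[R]_n := delta_mx j 0; have cl := @cvg_line_dnbhs R n x e.
pose N (t : R) := hessP (G (mul x)) (Bmx B (2^-1 *: (x + (x + t *: e)))).
apply: (@derive_expansion _ _ _ _ _ _ (fun t => 2^-1 * qform (N t) e)
  (2^-1 * qform (hessP (G (mul x)) (Bmx B x)) e)).
  near=> t; rewrite primal_expansion // [x + t *: e - x]addrC addKr.
  by rewrite dotZr dot_delta qformZr -/(N t); ring.
apply: cvgM; first exact: cvg_cst.
apply: cvg_qform; last exact: cvg_cst.
exact: cvg_hessP_midpoint.
Unshelve. all: by end_near. Qed.

Lemma gradient_primal x : gradient Pi x = pgrad x.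
Proof. by apply/matrixP => i j; rewrite ord1 mxE derive_primal. Qed.

Lemma hessian_primal x : hessian Pi x = hessP (G (mul x)) (Bmx B x).
Proof.
set H := hessP _ _; have Hs : H^T = H by rewrite hessP_sym // Gmx_sym.
(* Differentiating component j of the gradient along e_i produces entry (j, i), hence the passage to
   the transpose. *)
apply/matrixP => i j; rewrite [LHS]mxE -[in RHS]Hs [RHS]mxE.
rewrite (_ : (fun y => _) = (fun y => pgrad y j 0)); last first.
  by apply/funext => y; exact: derive_primal.
set e : 'cV[R]_n := delta_mx i 0; have cl := @cvg_line_dnbhs R n x e.
pose N (t : R) := G (mul (x + t *: e)) +
  Bmx B x *m (Bmx B (2^-1 *: (x + (x + t *: e))))^T.
apply: (@derive_carath _ _ _ _ _ (fun t => (N t *m e) j 0)).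
  near=> t.
  have -> : t * (N t *m e) j 0 = (pgrad (x + t *: e) - pgrad x) j 0.
    have -> : t * (N t *m e) j 0 = (N t *m (t *: e)) j 0 by rewrite -scalemxAr [RHS]mxE.
    by rewrite primal_gradB // [x + _ - x]addrC addKr.
  by rewrite [RHS]mxE [(- pgrad x) _ _]mxE.
have -> : H j i = (H *m e) j 0.
  by rewrite -colE [RHS]mxE.
apply: cvg_coord; apply: cvg_mulmx; last exact: cvg_cst.
apply: cvgD; first exact: cvg_Gmx (cvg_multiplier cl).
apply: cvg_mulmx; first exact: cvg_cst.
exact: cvg_trmx (cvg_Bmx (cvg_midpoint cl)).
Unshelve. all: by end_near. Qed.

Lemma primal_has_expansion x : pgrad x = 0 ->
  has_expansion Pi x (hessP (G (mul x)) (Bmx B x)).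
Proof.
move=> gx; pose N y := hessP (G (mul x)) (Bmx B (2^-1 *: (x + y))).
have cN : N y @[y --> x] --> hessP (G (mul x)) (Bmx B x).
  exact: (@cvg_hessP_midpoint _ (nbhs x) _ _ x id cvg_id).
exists N => //; near=> y.
by rewrite primal_expansion // gx /dot trmx0 mul0mx mxE add0r.
Unshelve. all: by end_near. Qed.

Lemma derive_dual s j : G s \in unitmx ->
  'D_(delta_mx j 0) Pid s = dgrad s j 0.
Proof.
move=> Gs; set e : 'cV[R]_m := delta_mx j 0; have cl := @cvg_line_dnbhs R m s e.
pose N r := hessD (G r) (Bmx B (sol s)).
apply: (@derive_expansion _ _ _ _ _ _ (fun t => 2^-1 * qform (N (s + t *: e)) e)
  (2^-1 * qform (N s) e)).
  near=> t; rewrite dual_expansion //; last by near: t; exact: cl (near_Gmx_unitmx Gs).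
  rewrite [s + t *: e - s]addrC addKr.
  by rewrite dotZr dot_delta qformZr -/(N _); ring.
apply: cvgM; first exact: cvg_cst.
apply: cvg_qform; last exact: cvg_cst.
exact: cvg_hessD.
Unshelve. all: by end_near. Qed.

Lemma hessian_dual s : G s \in unitmx -> hessian Pid s = hessD (G s) (Bmx B (sol s)).
Proof.
move=> Gs; set H := hessD _ _; have Hs : H^T = H by rewrite hessD_sym // Gmx_sym.
apply/matrixP => i j; rewrite [LHS]mxE -[in RHS]Hs [RHS]mxE.
set e : 'cV[R]_m := delta_mx i 0; have cl := @cvg_line_dnbhs R m s e.
pose K r := (Bmx B (2^-1 *: (sol s + sol r)))^T *m (invmx (G r) *m Bmx B (sol s)).
pose N (t : R) := - (K (s + t *: e) + 1%:M).
have near_unit := near_Gmx_unitmx Gs.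
apply: (@derive_carath _ _ _ _ _ (fun t => (N t *m e) j 0)).
  (* The gradient formula is available only where G is invertible, so it is used for small t rather
     than as an equality of functions. *)
  near=> t.
  have Gt : G (s + t *: e) \in unitmx by near: t; exact: cl near_unit.
  rewrite !derive_dual //.
  have -> : t * (N t *m e) j 0 = (N t *m (t *: e)) j 0 by rewrite -scalemxAr [RHS]mxE.
  have -> : N t *m (t *: e) = dgrad (s + t *: e) - dgrad s.
    by rewrite dual_gradientB // [s + _ - s]addrC addKr.
  by rewrite [RHS]mxE [(- dgrad s) _ _]mxE.
have -> : H j i = (H *m e) j 0 by rewrite -colE [RHS]mxE.
apply: cvg_coord; apply: cvg_mulmx; last exact: cvg_cst.
have -> : H = - ((Bmx B (sol s))^T *m (invmx (G s) *m Bmx B (sol s)) + 1%:M).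
  by rewrite mulmxA addrC.
apply: cvgN; apply: cvgD; last exact: cvg_cst.
rewrite /K; apply: cvg_mulmx.
  by apply: cvg_trmx; apply: cvg_Bmx; apply: cvg_midpoint; exact: cvg_dual_sol.
by apply: cvg_mulmx; [apply: cvg_invmx => //; exact: cvg_Gmx|exact: cvg_cst].
Unshelve. all: by end_near. Qed.

Lemma dual_has_expansion s : G s \in unitmx -> dgrad s = 0 ->
  has_expansion Pid s (hessD (G s) (Bmx B (sol s))).
Proof.
move=> Gs gs; exists (fun r => hessD (G r) (Bmx B (sol s))).
  exact: (@cvg_hessD _ (nbhs s) _ _ s id Gs cvg_id).
apply: filterS (near_Gmx_unitmx Gs) => r Gr.
by rewrite dual_expansion // gs /dot trmx0 mul0mx mxE add0r.
Qed.

(** Negative definiteness is an open condition and implies invertibility, hence membership in [Sa].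
    So extrema relative to [Sa] are ordinary local extrema at such a point. *)
Lemma near_Sa_minus s : negdef (G s) -> \forall r \near s, Sa_minus A B f r.
Proof.
move=> Gn; have Gs := negdef_unitmx Gn.
have Gsym : (- G s)^T = - G s by rewrite linearN /= Gmx_sym.
have Gp : posdef (- G s) by apply/negdefP => //; exact: Gmx_sym.
have cG : - G r @[r --> s] --> - G s.
  exact: (cvgN (@cvg_Gmx _ (nbhs s) _ id s cvg_id)).
apply: filterS (near_posdef Gsym Gp cG) => r Grp.
have Gr : negdef (G r) by apply/negdefP => //; exact: Gmx_sym.
by split=> //; apply: Sa_unitmx; exact: negdef_unitmx.
Qed.

End Derivatives.

(** * Duality *)

(** Deciding [C] classically allows one neighbourhood to be fixed before it is known which case
    occurs. *)
Lemma near_imply (T : topologicalType) (x : T) (C : Prop) (Q : T -> Prop) :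
  (C -> \forall y \near x, Q y) -> \forall y \near x, C -> Q y.
Proof.
have [c /(_ c)|nc _] := pselect C; first by apply: filterS.
by apply: filterE => y /nc.
Qed.

Lemma local_minimizer_near (R : realType) (T : topologicalType) (D : set T)
    (g : T -> R) x : nbhs x D ->
  local_minimizer D g x <-> \forall y \near x, g x <= g y.
Proof.
move=> xD; split=> [[_]|gx].
  by rewrite near_withinE => gx; apply: filterS2 xD gx => y Dy; apply.
split; first exact: nbhs_singleton.
by rewrite near_withinE; apply: filterS gx => y.
Qed.

Lemma local_maximizer_near (R : realType) (T : topologicalType) (D : set T)
    (g : T -> R) x : nbhs x D -> local_maximizer D g x ->
  \forall y \near x, g y <= g x.
Proof.
by move=> xD [_]; rewrite near_withinE => gx; apply: filterS2 xD gx => y Dy; apply.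
Qed.

Section Duality.
Context {R : realType} {n m : nat}.
Context (A : 'M[R]_n) (B : 'I_m -> 'M[R]_n) (f : 'cV[R]_n) (d : 'cV[R]_m).
Hypotheses (A_sym : A^T = A) (B_sym : forall k, (B k)^T = B k).
Hypothesis nonsingular : forall x : 'cV[R]_n, primal_critical A B f d x ->
  \det (hessian (primal A B f d) x) <> 0.

Local Notation Pi := (primal A B f d).
Local Notation Pid := (dual A B f d).
Local Notation G := (Gmx A B).
Local Notation sol := (dual_sol A B f).

Lemma dual_critical_multiplier s : dual_critical A B f d s ->
  multiplier B d (sol s) = s.
Proof. by move=> [_] /eqP; rewrite dual_gradientE // subr_eq0 => /eqP. Qed.

(** Both squares of the gap vanish at a critical pair. *)
Lemma dual_critical_value s : dual_critical A B f d s -> Pi (sol s) = Pid s.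
Proof.
move=> sc; apply/eqP; rewrite -subr_eq0.
rewrite (primal_dual_gap d A_sym B_sym _ (dual_solE (proj1 sc))).
by rewrite dual_critical_multiplier // !subrr dot0r qform0 !mulr0 addr0.
Qed.

(** The gap to the fixed dual value at s is nonnegative for every primal point. *)
Lemma primal_global_min s : dual_critical A B f d s -> Sa_plus A B f s ->
  is_min_over [set: 'cV[R]_n] Pi (Pi (sol s)).
Proof.
move=> sc [Ss [_ Gs]]; split; first by exists (sol s).
move=> _ [x _ <-]; change (Pi (sol s) <= Pi x).
rewrite (dual_critical_value sc) -subr_ge0.
rewrite (primal_dual_gap d A_sym B_sym _ (dual_solE Ss)).
by rewrite addr_ge0 // mulr_ge0 ?invr_ge0 ?dot_ge0 ?Gs.
Qed.

(** The same gap, now with the primal point fixed and the dual point varying. *)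
Lemma dual_global_max s : dual_critical A B f d s -> Sa_plus A B f s ->
  is_max_over (Sa_plus A B f) Pid (Pid s).
Proof.
move=> sc Sps; split; first by exists s.
move=> _ [r [Sr [_ Gr]] <-]; change (Pid r <= Pid s).
rewrite -(dual_critical_value sc) -subr_ge0.
rewrite (primal_dual_gap d A_sym B_sym _ (dual_solE Sr)).
by rewrite addr_ge0 // mulr_ge0 ?invr_ge0 ?dot_ge0 ?Gr.
Qed.

(** * Dual critical points where G is negative definite *)

Section NegativeDefinite.
Variable s : 'cV[R]_m.
Hypotheses (sc : dual_critical A B f d s) (Gneg : negdef (G s)).

Let x := sol s.
Let F := Bmx B x.
Let Gu : G s \in unitmx := negdef_unitmx Gneg.
Let Gsym : (G s)^T = G s := Gmx_sym A_sym B_sym s.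
Let mulx : multiplier B d x = s := dual_critical_multiplier sc.

Let pgrad0 : primal_grad A B f d x = 0.
Proof. by rewrite /primal_grad mulx -(dual_solE (proj1 sc)) subrr. Qed.

Let dgrad0 : dual_gradient A B f d s = 0 := proj2 sc.

Lemma critical_hessian_primal : hessian Pi x = hessP (G s) F.
Proof. by rewrite hessian_primal // mulx. Qed.

Lemma critical_hessian_dual : hessian Pid s = hessD (G s) F.
Proof. exact: hessian_dual. Qed.

Lemma primal_critical_sol : primal_critical A B f d x.
Proof. by rewrite /primal_critical /= gradient_primal. Qed.

Let Pexp : has_expansion Pi x (hessP (G s) F).
Proof. by rewrite /F -[in G s]mulx; apply: primal_has_expansion. Qed.

Let Dexp : has_expansion Pid s (hessD (G s) F).
Proof. exact: dual_has_expansion. Qed.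

Let Psym := hessP_sym F Gsym.
Let Dsym := hessD_sym F Gsym.

Let Pu : hessP (G s) F \in unitmx.
Proof.
rewrite unitmxE unitfE -critical_hessian_primal; apply/eqP.
exact: nonsingular primal_critical_sol.
Qed.

Let Du : hessD (G s) F \in unitmx := hessD_unitmx Gu Pu.

(** The necessary condition gives only a semidefinite Hessian; nonsingularity upgrades it to a
    definite one, which is sufficient. *)
Lemma primal_max_negdef :
  (\forall y \near x, Pi y <= Pi x) <-> negdef (hessP (G s) F).
Proof.
split=> [Pmax|]; last exact: expansion_max.
by apply: psd_negdef => //; exact: max_expansion Pmax.
Qed.

Lemma dual_max_negdef :
  (\forall r \near s, Pid r <= Pid s) <-> negdef (hessD (G s) F).
Proof.
split=> [Pmax|]; last exact: expansion_max.
by apply: psd_negdef => //; exact: max_expansion Pmax.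
Qed.

Lemma primal_min_posdef :
  (\forall y \near x, Pi x <= Pi y) -> posdef (hessP (G s) F).
Proof. by move=> Pmin; apply: psd_posdef => //; exact: min_expansion Pmin. Qed.

Lemma dual_min_posdef :
  (\forall r \near s, Pid s <= Pid r) -> posdef (hessD (G s) F).
Proof. by move=> Pmin; apply: psd_posdef => //; exact: min_expansion Pmin. Qed.

Let Sa_nbhs : nbhs s (Sa A B f).
Proof. by apply: filterS (near_Sa_minus f A_sym B_sym Gneg) => r []. Qed.

(** As m < n, F^T has a kernel vector, at which the Hessian form is that of G, hence negative. The
    range of G^-1 F supplies a positive direction. *)
Lemma primal_saddle : (m < n)%N -> posdef (hessD (G s) F) -> (0 < m)%N ->
  saddle_point (primal_critical A B f d) [set: 'cV[R]_n] Pi x.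
Proof.
move=> mn Dp m0; split; first exact: primal_critical_sol.
  move=> /(local_minimizer_near _ filterT) /(min_expansion Pexp) Pge.
  have [h h0 Fh] := exists_kernel F^T mn.
  have := Pge h; rewrite qform_hessP Fh dot0r addr0 leNgt => /negP; apply.
  exact: (proj2 Gneg).
move=> /(local_maximizer_near filterT) /(max_expansion Pexp) Ple.
pose u : 'cV[R]_m := delta_mx (Ordinal m0) 0.
have u0 : u != 0.
  apply/eqP => /matrixP/(_ (Ordinal m0) 0); rewrite !mxE !eqxx => /eqP.
  by rewrite oner_eq0.
have := congr_hessP_posdef Gsym Gu Dp u0; rewrite -qform_mulmx.
by rewrite ltNge Ple.
Qed.

(** As n < m, F has a kernel vector h, where the Hessian form is -|h|^2. The range of F^T supplies a
    positive direction. *)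
Lemma dual_saddle : (n < m)%N -> posdef (hessP (G s) F) -> (0 < n)%N ->
  saddle_point (dual_critical A B f d) (Sa A B f) Pid s.
Proof.
move=> nm Pp n0; split; first exact: sc.
  move=> /(local_minimizer_near _ Sa_nbhs) /(min_expansion Dexp) Dge.
  have [h h0 Fh] := exists_kernel F nm.
  have := Dge h; rewrite qform_hessD Fh qform0 addr0 leNgt => /negP; apply.
  by rewrite oppr_lt0 dot_gt0.
move=> /(local_maximizer_near Sa_nbhs) /(max_expansion Dexp) Dle.
pose u : 'cV[R]_n := delta_mx (Ordinal n0) 0.
have u0 : u != 0.
  apply/eqP => /matrixP/(_ (Ordinal n0) 0); rewrite !mxE !eqxx => /eqP.
  by rewrite oner_eq0.
have := congr_hessD_posdef Gneg Pp u0; rewrite -{1}[F]trmxK -qform_mulmx.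
by rewrite ltNge Dle.
Qed.

Lemma double_min_duality : (0 < n)%N -> (0 < m)%N ->
  exists (Xo : set 'cV[R]_n) (So : set 'cV[R]_m),
    [/\ nbhs (x, s) (Xo `*` So), So `<=` Sa_minus A B f,
        is_max_over Xo Pi (Pi x) <-> is_max_over So Pid (Pid s),
        (m < n)%N -> local_minimizer (Sa A B f) Pid s ->
          saddle_point (primal_critical A B f d) [set: 'cV[R]_n] Pi x /\
          exists P : 'M[R]_(n, m),
            [/\ \rank P = m, possemidef (P^T *m hessian Pi x *m P),
                is_min_over (Xo `&` affine_span x P) Pi (Pi x),
                is_min_over So Pid (Pid s) & Pi x = Pid s]
      & (n < m)%N -> local_minimizer [set: 'cV[R]_n] Pi x ->
          saddle_point (dual_critical A B f d) (Sa A B f) Pid s /\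
          exists Q : 'M[R]_(m, n),
            [/\ \rank Q = n, possemidef (Q^T *m hessian Pid s *m Q),
                is_min_over Xo Pi (Pi x),
                is_min_over (So `&` affine_span s Q) Pid (Pid s)
              & Pi x = Pid s]].
Proof.
move=> n0 m0; pose P := invmx (G s) *m F; pose Q := F^T.
(* One pair of sets must serve every claim, so each collects the points satisfying all inequalities
   any case may require, each under its own condition. *)
pose Xo := [set y | [/\ negdef (hessP (G s) F) -> Pi y <= Pi x,
  posdef (hessD (G s) F) -> affine_span x P y -> Pi x <= Pi y
  & local_minimizer [set: 'cV[R]_n] Pi x -> Pi x <= Pi y]].
pose So := Sa_minus A B f `&` [set r | [/\ negdef (hessD (G s) F) -> Pid r <= Pid s,
  posdef (hessP (G s) F) -> affine_span s Q r -> Pid s <= Pid r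
  & local_minimizer (Sa A B f) Pid s -> Pid s <= Pid r]].
have xXo : nbhs x Xo.
  have Pmax : \forall y \near x, negdef (hessP (G s) F) -> Pi y <= Pi x.
    by apply: near_imply => /primal_max_negdef.
  have Pspan : \forall y \near x,
      posdef (hessD (G s) F) -> affine_span x P y -> Pi x <= Pi y.
    apply: near_imply => Dp; apply: expansion_min Psym Pexp _.
    exact: congr_hessP_posdef.
  have Pmin : \forall y \near x,
      local_minimizer [set: 'cV[R]_n] Pi x -> Pi x <= Pi y.
    by apply: near_imply => /(local_minimizer_near _ filterT).
  exact: filterS3 Pmax Pspan Pmin.
have sSo : nbhs s So.
  apply: filterI; first exact: near_Sa_minus.
  have Dmax : \forall r \near s, negdef (hessD (G s) F) -> Pid r <= Pid s.
    by apply: near_imply => /dual_max_negdef.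
  have Dspan : \forall r \near s,
      posdef (hessP (G s) F) -> affine_span s Q r -> Pid s <= Pid r.
    apply: near_imply => Pp; apply: expansion_min Dsym Dexp _.
    by rewrite /Q trmxK; apply: congr_hessD_posdef.
  have Dmin : \forall r \near s, local_minimizer (Sa A B f) Pid s -> Pid s <= Pid r.
    by apply: near_imply => /(local_minimizer_near _ Sa_nbhs).
  exact: filterS3 Dmax Dspan Dmin.
have xX := nbhs_singleton xXo; have sS := nbhs_singleton sSo.
have xP p (M : 'M[R]_(n, p)) : affine_span x M x.
  by apply/affine_spanP; exists 0; rewrite mulmx0 addr0.
have sP p (M : 'M[R]_(m, p)) : affine_span s M s.
  by apply/affine_spanP; exists 0; rewrite mulmx0 addr0.
exists Xo, So; split.
- by exists (Xo, So).
- by move=> r [].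
(* A maximum over a neighbourhood is local and makes one Hessian negative definite, hence also the
   other; the definition of the opposite set then yields its maximum. *)
- split=> [[_ Pmax]|[_ Dmax]].
    have /primal_max_negdef/(hessP_hessD_negdef _ Gneg) Dn :
        \forall y \near x, Pi y <= Pi x.
      by apply: filterS xXo => y Xy; apply: Pmax; exists y.
    split; first by exists s.
    by move=> _ [r [_ [Dr _ _]] <-]; exact: Dr.
  have /dual_max_negdef/(hessP_hessD_negdef _ Gneg) Pn :
      \forall r \near s, Pid r <= Pid s.
    by apply: filterS sSo => r Sr; apply: Dmax; exists r.
  split; first by exists x.
  by move=> _ [y [Py _ _] <-]; exact: Py.
- move=> mn smin.
  have Dp : posdef (hessD (G s) F).
    by apply: dual_min_posdef; apply/(local_minimizer_near _ Sa_nbhs).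
  split; first exact: primal_saddle.
  have Pp := congr_hessP_posdef Gsym Gu Dp.
  exists P; split.
  + exact: rank_hessD_posdef.
  + rewrite critical_hessian_primal; split; first exact: congr_sym.
    by move=> u; exact: posdef_ge0.
  + split; first by exists x.
    by move=> _ [y [[_ Py _] yP] <-]; exact: Py.
  + split; first by exists s.
    by move=> _ [r [_ [_ _ Dr]] <-]; exact: Dr.
  + exact: dual_critical_value.
- move=> nm xmin.
  have Pp : posdef (hessP (G s) F).
    by apply: primal_min_posdef; apply/(local_minimizer_near _ filterT).
  split; first exact: dual_saddle.
  exists Q; split.
  + exact: rank_hessP_posdef Gneg Pp.
  + rewrite critical_hessian_dual; split; first exact: congr_sym.
    by move=> u; apply: posdef_ge0; rewrite /Q trmxK; apply: congr_hessD_posdef.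
  + split; first by exists x.
    by move=> _ [y [_ _ Py] <-]; exact: Py.
  + split; first by exists s.
    by move=> _ [r [[_ [_ Dr _]] rQ] <-]; exact: Dr.
  + exact: dual_critical_value.
Qed.

End NegativeDefinite.
End Duality.

Theorem theorem4p3 (R : realType) (n m : nat)
    (A : 'M[R]_n) (B : 'I_m -> 'M[R]_n) (f : 'cV[R]_n) (d : 'cV[R]_m)
    (n_gt0 : (0 < n)%N) (m_gt0 : (0 < m)%N)
    (A_sym : A^T = A) (B_sym : forall k, (B k)^T = B k)
    (n_neq_m : n <> m)
    (nonsingular : forall x : 'cV[R]_n, primal_critical A B f d x ->
       \det (hessian (primal A B f d) x) <> 0)
    (sbar : 'cV[R]_m) (sbar_crit : dual_critical A B f d sbar)
    (xbar : 'cV[R]_n) (xbarE : xbar = mpinvmx (Gmx A B sbar) *m f) :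
  let Pi := primal A B f d in
  let Pid := dual A B f d in
  (Sa_plus A B f sbar ->
     (is_min_over [set: 'cV[R]_n] Pi (Pi xbar) <->
      is_max_over (Sa_plus A B f) Pid (Pid sbar)))
  /\
  (Sa_minus A B f sbar ->
     exists (Xo : set 'cV[R]_n) (So : set 'cV[R]_m),
       [/\ nbhs (xbar, sbar) (Xo `*` So),
           So `<=` Sa_minus A B f,
           is_max_over Xo Pi (Pi xbar) <-> is_max_over So Pid (Pid sbar),
           (m < n)%N -> local_minimizer (Sa A B f) Pid sbar ->
             saddle_point (primal_critical A B f d) [set: 'cV[R]_n] Pi xbar /\
             exists P : 'M[R]_(n, m),
               [/\ \rank P = m,
                   possemidef (P^T *m hessian Pi xbar *m P),
                   is_min_over (Xo `&` affine_span xbar P) Pi (Pi xbar),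
                   is_min_over So Pid (Pid sbar) &
                   Pi xbar = Pid sbar]
         & (n < m)%N -> local_minimizer [set: 'cV[R]_n] Pi xbar ->
             saddle_point (dual_critical A B f d) (Sa A B f) Pid sbar /\
             exists Q : 'M[R]_(m, n),
               [/\ \rank Q = n,
                   possemidef (Q^T *m hessian Pid sbar *m Q),
                   is_min_over Xo Pi (Pi xbar),
                   is_min_over (So `&` affine_span sbar Q) Pid (Pid sbar) &
                   Pi xbar = Pid sbar]]).
Proof.
subst xbar; split=> [sp|[_ Gneg]]; last exact: double_min_duality.
(* In case (i) both sides of the equivalence hold outright. *)
by split=> _; [exact: dual_global_max|exact: primal_global_min].
Qed.
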